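(* Let $(E_j)_{j\ge1}$ be i.i.d. standard exponential random variables and $(U_j)_{j\ge1}$ i.i.d. uniform $[0,1]$ random variables, all independent. For $k\ge1$ let $$A_k=\Big(E_1+\frac{E_2}{U_1}+\dots+\frac{E_k}{U_1\cdots U_{k-1}}\Big)\big(1-U_1\cdots U_k\big).$$ Then for every integer $k\ge1$ and every $s>0$, $$P(A_k>s)=-I(s)\int_0^s e^{\xi}p_{k-1}(\xi)\,d\xi+\sum_{j=0}^{k-1}p_j(s).$$
   Context: $\sigma_1(k,j)$ are the unsigned Stirling numbers of the first kind ($\sigma_1(k,j)=0$ for $k<j$, $\sigma_1(0,0)=1$); $p_j(t)=e^{-t}\sum_{k=j}^\infty \frac{t^k}{k!}\frac{\sigma_1(k,j)}{k!}$ for $j\ge0$; $I(s)=\int_s^\infty \frac{e^{-\xi}}{\xi}\,d\xi$. *)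

(* Defs.v *)
From HB Require Import structures.
From mathcomp Require Import all_boot all_order all_algebra.
From mathcomp Require Import all_classical all_reals all_analysis.
Set Implicit Arguments. Unset Strict Implicit. Unset Printing Implicit Defensive.
Import Order.TTheory GRing.Theory Num.Theory.
Import numFieldNormedType.Exports.
Local Open Scope classical_set_scope.
Local Open Scope ring_scope.

Fixpoint stirling1 (n j : nat) : nat :=
  match n, j with
  | 0, 0 => 1
  | 0, _.+1 => 0
  | _.+1, 0 => 0
  | n'.+1, j'.+1 => n' * stirling1 n' j'.+1 + stirling1 n' j'
  end.

Definition pj {R : realType} (j : nat) (t : R) : R :=
  expR (- t) *
  limn (fun n : nat => \sum_(j <= k < n)
          (t ^+ k / (k`!)%:R * ((stirling1 k j)%:R / (k`!)%:R))).

Definition Iexp {R : realType} (s : R) : R :=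
  Rintegral lebesgue_measure `[s, +oo[ (fun xi : R => expR (- xi) / xi).

Definition mutually_independent {d : measure_display} {T : measurableType d}
  {R : realType} (P : probability T R) {I : eqType} (X : I -> T -> R) : Prop :=
  forall (J : seq I) (B : I -> set R), uniq J ->
    (forall i, measurable (B i)) ->
    P (\bigcap_(i in [set i | i \in J]) (X i @^-1` B i)) =
    (\prod_(i <- J) P (X i @^-1` B i))%E.

(* the variable A_k, with 0-based indexing: E j = E_{j+1}, U j = U_{j+1} *)
Definition A_k {T : Type} {R : realType} (E U : nat -> T -> R) (k : nat) (w : T) : R :=
  (\sum_(i < k) E i w / \prod_(l < i) U l w) * (1 - \prod_(l < k) U l w).

(* Main.v *)
Require Import Defs.
From HB Require Import structures.
From mathcomp Require Import all_boot all_order all_algebra.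
From mathcomp Require Import ring.
From mathcomp Require Import all_classical all_reals all_analysis.
From mathcomp Require Import measurable_realfun.
Import Order.TTheory GRing.Theory Num.Theory.
Import numFieldNormedType.Exports.
Local Open Scope classical_set_scope.
Local Open Scope ring_scope.

Set Implicit Arguments. Unset Strict Implicit. Unset Printing Implicit Defensive.

(** Put [V_k = U_1 ... U_k] and [S_k = E_1 + E_2 / V_1 + ... + E_k / V_(k-1)], so
    that [A_k = S_k (1 - V_k)]. The pair [(S_k, V_k)] is a Markov chain: the
    [k]-th record time and the [k]-th record value of uniform points arriving at
    rate one. With [g_j x = e^x p_j(x) = sum_m s(m, j) x^m / m!^2], the Stirling
    recurrence is the equation [x g_j'' + g_j' - x g_j' = g_(j-1)], and it shows by
    induction on [k] that [(S_k, V_k)] has density [e^-t g_(k-1)(t (1 - v))] on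
    [t >= 0], [0 < v <= 1]. With [Q = sum_(j < k) (g_j - g_j')] the equations
    telescope to [(y Q)' = g_(k-1)], while [(sum_(j < k) p_j)' = - e^-y Q]. Hence
    integrating the density over [t (1 - v) <= s], first in [v] and then in [t],
    gives
    [P (A_k <= s) = int_0^s e^-t Q(t) dt + int_s^oo e^-t (s / t) Q(s) dt
                  = 1 - sum_(j < k) p_j(s) + I(s) int_0^s g_(k-1).] *)

(** * Power series dominated by the exponential series *)

Section entire_series.
Context {R : realType}.
Implicit Types (c : R^nat) (x : R).

(** Domination by the coefficients of the exponential gives convergence on all of [R] and passes to
    the formal derivative, so one condition serves a series and all its derivatives. *)
Definition exp_bounded c := forall m, 0 <= c m <= (m`!%:R)^-1.

Definition psum c x : R := limn (pseries c x).

Lemma exp_bounded_diffs c : exp_bounded c -> exp_bounded (pseries_diffs c).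
Proof.
move=> cb m; rewrite /pseries_diffs; have /andP[c0 c1] := cb m.+1.
rewrite mulr_ge0//= mulrC -ler_pdivlMr ?ltr0n//.
by rewrite (le_trans c1)// factS natrM invfM mulrC.
Qed.

Lemma exp_bounded_cvg c x : exp_bounded c -> cvgn (pseries c x).
Proof.
move=> cb; apply: normed_cvg.
apply: (@series_le_cvg _ _ (exp_coeff `|x|)) => //.
- by move=> n; exact: normr_ge0.
- by move=> n; exact: exp_coeff_ge0.
- move=> n; rewrite /= normrM normrX /exp_coeff /= mulrC ler_wpM2l ?exprn_ge0//.
  by have /andP[c0 c1] := cb n; rewrite ger0_norm.
- exact: is_cvg_series_exp_coeff.
Qed.

Lemma is_derive_psum c x : exp_bounded c ->
  is_derive x 1 (psum c) (psum (pseries_diffs c) x).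
Proof.
(* The radius [|x| + 1] lies strictly beyond [|x|], and the series and its first two formal
   derivatives converge there. *)
move=> cb; apply: (@pseries_snd_diffs _ c (`|x| + 1)).
- exact: exp_bounded_cvg.
- exact/exp_bounded_cvg/exp_bounded_diffs.
- exact/exp_bounded_cvg/exp_bounded_diffs/exp_bounded_diffs.
- by rewrite [ltRHS]ger0_norm ?addr_ge0// ltrDl.
Qed.

Lemma psum_ge0 c x : exp_bounded c -> 0 <= x -> 0 <= psum c x.
Proof.
move=> cb x0; apply: limr_ge; first exact: exp_bounded_cvg.
apply: nearW => n; rewrite /pseries /series /=; apply: sumr_ge0 => i _.
by have /andP[c0 _] := cb i; rewrite mulr_ge0// exprn_ge0.
Qed.

Lemma pseries0 c n : pseries c 0 n.+1 = c 0%N.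
Proof.
rewrite /pseries /series /= big_nat_recl// expr0 mulr1 big1 ?addr0// => i _.
by rewrite expr0n mulr0.
Qed.

Lemma psum0 c : psum c 0 = c 0%N.
Proof.
apply/cvg_lim => //; rewrite -cvg_shiftS.
suff -> : (fun n => pseries c 0 n.+1) = cst (c 0%N) by exact: cvg_cst.
by apply/funext => n; exact: pseries0.
Qed.

(** Coefficients of [x] times the series. *)
Definition cshift c : R^nat := fun m => if m is m'.+1 then c m' else 0.

Lemma cvg_pseries_shift c x : exp_bounded c ->
  pseries (cshift c) x @ \oo --> x * psum c x.
Proof.
move=> cb; rewrite -cvg_shiftS.
suff -> : (fun n => pseries (cshift c) x n.+1) = (fun n => x * pseries c x n).
  by apply: cvgM; [exact: cvg_cst|exact: exp_bounded_cvg].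
apply/funext => n; rewrite /pseries /series /= big_nat_recl//= mul0r add0r.
by rewrite mulr_sumr; apply: eq_bigr => i _; rewrite exprS mulrCA.
Qed.

End entire_series.

(** * Stirling generating functions and their differential equation *)

Section stirling_series.
Context {R : realType}.

Lemma stirling1_le_fact m j : (stirling1 m j <= m`!)%N.
Proof.
(* Two neighbouring columns are bounded together: away from column 0, the pair sum in row [m + 1] is
   [m] times one pair sum of row [m] plus an adjacent one, hence at most [m * m! + m!]. *)
suff: (stirling1 m j + stirling1 m j.+1 <= m`!)%N.
  exact: leq_trans (leq_addr _ _).
elim: m j => [|m IH] [|j]//=.
  rewrite add0n factS mulSn addnC leq_add//.
    exact: leq_trans (leq_addr _ _) (IH 0%N).
  by rewrite leq_mul2l (leq_trans _ (IH 0%N)) ?leq_addl ?orbT.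
by rewrite addnACA -mulnDr factS mulSn addnC leq_add// leq_mul2l IH orbT.
Qed.

Definition stirling_coef (j m : nat) : R := (stirling1 m j)%:R / (m`!%:R) ^+ 2.

Lemma stirling_coef_bounded j : exp_bounded (stirling_coef j).
Proof.
move=> m; rewrite /stirling_coef divr_ge0 ?exprn_ge0//=.
rewrite expr2 invfM mulrA ler_piMl ?invr_ge0//.
by rewrite ler_pdivrMr ?ltr0n ?fact_gt0// mul1r ler_nat stirling1_le_fact.
Qed.

Lemma stirling1_small m j : (m < j)%N -> stirling1 m j = 0%N.
Proof.
elim: m j => [|m IH] [|j]//= mj.
by rewrite !IH ?muln0//; exact: ltnW.
Qed.

(** The functions [g_j], [g_j'], [g_j''], the last two as sums of the formally differentiated
    series. *)
Definition stirling_gen (j : nat) (x : R) : R := psum (stirling_coef j) x.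
Definition stirling_gen1 (j : nat) (x : R) : R :=
  psum (pseries_diffs (stirling_coef j)) x.
Definition stirling_gen2 (j : nat) (x : R) : R :=
  psum (pseries_diffs (pseries_diffs (stirling_coef j))) x.

Lemma is_derive_stirling_gen j (x : R) :
  is_derive x 1 (stirling_gen j) (stirling_gen1 j x).
Proof. exact/is_derive_psum/stirling_coef_bounded. Qed.

Lemma is_derive_stirling_gen1 j (x : R) :
  is_derive x 1 (stirling_gen1 j) (stirling_gen2 j x).
Proof. exact/is_derive_psum/exp_bounded_diffs/stirling_coef_bounded. Qed.

Lemma stirling_gen_ge0 j (x : R) : 0 <= x -> 0 <= stirling_gen j x.
Proof. exact/psum_ge0/stirling_coef_bounded. Qed.

Lemma stirling_gen_at0 j : stirling_gen j 0 = (j == 0%N)%:R.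
Proof.
rewrite /stirling_gen psum0 /stirling_coef fact0 expr1n divr1.
by case: j.
Qed.

Lemma stirling_coef0S m : stirling_coef 0 m.+1 = 0 :> R.
Proof. by rewrite /stirling_coef /= mul0r. Qed.

Lemma stirling_gen0 (x : R) : stirling_gen 0 x = 1.
Proof.
apply/cvg_lim => //; rewrite -cvg_shiftS.
suff -> : (fun n => pseries (stirling_coef 0) x n.+1) = cst 1 by exact: cvg_cst.
apply/funext => n; rewrite /pseries /series /= big_nat_recl//= big1.
  by rewrite expr0 mulr1 addr0 /stirling_coef fact0 expr1n divr1.
by move=> i _; rewrite stirling_coef0S mul0r.
Qed.

Lemma stirling_gen1_0 (x : R) : stirling_gen1 0 x = 0.
Proof.
rewrite -(@derive_val _ _ _ _ _ _ _ (is_derive_stirling_gen 0 x)).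
rewrite (_ : stirling_gen 0 = cst 1) ?derive_cst//.
by apply/funext => y; exact: stirling_gen0.
Qed.

Lemma stirling_gen2_0 (x : R) : stirling_gen2 0 x = 0.
Proof.
rewrite -(@derive_val _ _ _ _ _ _ _ (is_derive_stirling_gen1 0 x)).
rewrite (_ : stirling_gen1 0 = cst 0) ?derive_cst//.
by apply/funext => y; exact: stirling_gen1_0.
Qed.

(** With [c_m = s(m, j+1) / m!^2], the left side is [(m+1)^2 c_(m+1) - m c_m], the coefficient of
    [x^m] in [x f'' + f' - x f']. Multiplied by [m!^2] the claim reads
    [s(m+1, j+1) - m s(m, j+1) = s(m, j)]. *)
Lemma stirling_coef_rec j m : let c : R^nat := stirling_coef j.+1 in
  cshift (pseries_diffs (pseries_diffs c)) m + pseries_diffs c m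
  - cshift (pseries_diffs c) m = stirling_coef j m.
Proof.
rewrite /pseries_diffs /stirling_coef.
rewrite /cshift; case: m => [|m].
  by rewrite /= add0r subr0 !mul0n add0n mul1r !fact0 factS.
have -> : stirling1 m.+2 j.+1
    = (m.+1 * stirling1 m.+1 j.+1 + stirling1 m.+1 j)%N by [].
move: (stirling1 m.+1 j.+1) (stirling1 m.+1 j) => a b.
rewrite [(m.+1 * a + b)%:R]natrD !factS !natrM.
have := fact_gt0 m; rewrite -(ltr0n R) => /lt0r_neq0.
move: (m`!%:R : R) => F F0.
have m1 : m.+1%:R != 0 :> R by rewrite pnatr_eq0.
have m2 : m.+2%:R != 0 :> R by rewrite pnatr_eq0.
have E : m.+2%:R = m.+1%:R + 1 :> R by rewrite -natr1.
move: E m1 m2; move: (m.+2%:R : R) (m.+1%:R : R) => M N -> N0 M0.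
by field; rewrite ?N0 ?M0 ?F0.
Qed.

(* The differential equation encodes the recurrence
   s(m+1, j+1) = m s(m, j+1) + s(m, j). *)
Lemma stirling_gen_ode j (x : R) :
  x * stirling_gen2 j.+1 x + stirling_gen1 j.+1 x - x * stirling_gen1 j.+1 x
  = stirling_gen j x.
Proof.
set c := stirling_coef j.+1.
have cb : exp_bounded c := stirling_coef_bounded j.+1.
have c1b := exp_bounded_diffs cb.
have c2b := exp_bounded_diffs c1b.
apply/esym/cvg_lim => //.
have -> : pseries (stirling_coef j) x =
    pseries (cshift (pseries_diffs (pseries_diffs c))) x +
    pseries (pseries_diffs c) x - pseries (cshift (pseries_diffs c)) x.
  apply/funext => n; rewrite !fctE /pseries /series /=.
  rewrite -big_split/= -sumrB; apply: eq_bigr => m _.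
  rewrite -mulrDl -mulrBl; congr (_ * _).
  exact/esym/stirling_coef_rec.
apply: cvgB; last exact: cvg_pseries_shift.
by apply: cvgD; [exact: cvg_pseries_shift|exact: exp_bounded_cvg].
Qed.

(** Since [s(k, j) = 0] for [k < j], the sum may start at 0 and is then the power series of
    [g_j]. *)
Lemma pjE j (t : R) : pj j t = expR (- t) * stirling_gen j t.
Proof.
rewrite /pj; suff -> : (fun n : nat => \sum_(j <= k < n)
    (t ^+ k / (k`!)%:R * ((stirling1 k j)%:R / (k`!)%:R))) =
    pseries (stirling_coef j) t by [].
apply/funext => n.
rewrite /pseries /series /=.
have [jn|nj] := leqP j n; last first.
  rewrite big_geq ?(ltnW nj)//; apply/esym.
  rewrite big_nat big1// => i /andP[_ ilt].
  by rewrite /stirling_coef stirling1_small ?mul0r ?(ltn_trans ilt).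
rewrite [RHS](big_cat_nat _ (n := j))//= [X in X + _]big_nat [X in X + _]big1 ?add0r.
  by apply: eq_bigr => i _; rewrite /stirling_coef expr2 invfM; ring.
by move=> i /andP[_ ij]; rewrite /stirling_coef stirling1_small ?mul0r.
Qed.

End stirling_series.

(** * Integration against a measure with a density *)

Section integral_density.
Local Open Scope ereal_scope.
Context (d : measure_display) (T : measurableType d) (R : realType).
Variables (mu nu : {measure set T -> \bar R}) (q : T -> R).
Hypothesis mq : measurable_fun setT q.
Hypothesis q0 : forall x, (0 <= q x)%R.
Hypothesis nuE : forall A, measurable A -> nu A = \int[mu]_(x in A) (q x)%:E.

Import HBNNSimple.

Let integral_density_nnsfun (f : {nnsfun T >-> R}) :
  \int[nu]_x (f x)%:E = \int[mu]_x ((f x)%:E * (q x)%:E).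
Proof.
under [LHS]eq_integral do rewrite fimfunE -fsumEFin//.
rewrite [LHS]ge0_integral_fsum//; last 2 first.
  - by move=> r; exact/measurable_EFinP/measurableT_comp.
  - by move=> n x _; rewrite EFinM nnfun_muleindic_ge0.
under [RHS]eq_integral.
  move=> x xD; rewrite fimfunE -fsumEFin// ge0_mule_fsuml; last first.
    by move=> r; rewrite EFinM nnfun_muleindic_ge0.
  over.
rewrite [RHS]ge0_integral_fsum//; last 2 first.
  - by move=> r; apply: emeasurable_funM; apply/measurable_EFinP => //;
      exact: measurableT_comp.
  - move=> n x _; apply: mule_ge0; last by rewrite lee_fin.
    by rewrite EFinM nnfun_muleindic_ge0.
apply: eq_fsbigr => r /[!inE] -[t _ <-].
under eq_integral do rewrite EFinM.
under [RHS]eq_integral do rewrite EFinM -muleA.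
rewrite !ge0_integralZl//; last 5 first.
- by apply: emeasurable_funM => //; apply/measurable_EFinP.
- by move=> x _; rewrite mule_ge0// lee_fin.
- by rewrite lee_fin.
- exact/measurable_EFinP.
- by rewrite lee_fin.
congr (_ * _); rewrite integral_indic// setIT nuE//.
rewrite integral_mkcond; apply: eq_integral => x _.
by rewrite patchE indicE; case: ifPn => _; rewrite ?mul1e ?mul0e.
Qed.

(** For simple functions linearity reduces the claim to [nuE] on level sets; monotone convergence
    carries it to nonnegative measurable functions. *)
Lemma ge0_integral_density (f : T -> \bar R) : measurable_fun setT f ->
  (forall x, 0 <= f x) -> \int[nu]_x f x = \int[mu]_x (f x * (q x)%:E).
Proof.
move=> mf f0.
pose f_ := nnsfun_approx measurableT mf.
have cf x : EFin \o f_ ^~ x @ \oo --> f x by exact: cvg_nnsfun_approx.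
transitivity (limn (fun n => \int[nu]_x (f_ n x)%:E)).
  rewrite -monotone_convergence//=.
  - by apply: eq_integral => x _; apply/esym/cvg_lim => //; exact: cf.
  - by move=> n; exact/measurable_EFinP/measurable_funTS.
  - by move=> n ? _; rewrite lee_fin.
  - by move=> ? _ ? ? mn; rewrite lee_fin; exact/lefP/nd_nnsfun_approx.
transitivity (limn (fun n => \int[mu]_x ((f_ n x)%:E * (q x)%:E))).
  by apply: congr_lim; apply/funext => n; exact: integral_density_nnsfun.
rewrite -monotone_convergence//=.
- apply: eq_integral => x _; apply/cvg_lim => //.
  by apply: cvgeZr => //; exact: cf.
- move=> n; apply: emeasurable_funM => //; exact/measurable_EFinP.
- by move=> n x _; rewrite -EFinM lee_fin mulr_ge0.
- move=> x _ m n mn; rewrite -!EFinM lee_fin ler_wpM2r//.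
  exact/lefP/nd_nnsfun_approx.
Qed.

End integral_density.

(** * Affine change of variables for Lebesgue measure *)

Section affine_substitution.
Local Open Scope ereal_scope.
Context {R : realType}.
Notation mu := (@lebesgue_measure R).

(** The right side is a measure in [A] that gives each []x, y]] its length, and Lebesgue measure is
    the only one that does. *)
Lemma lebesgue_measure_affine (a b : R) : (0 < a)%R ->
  forall A : set R, measurable A ->
  mu A = a%:E * mu ((fun x => a * x + b)%R @^-1` A).
Proof.
move=> a0 A mA.
have mphi : @measurable_fun _ _ (measurableTypeR R) (measurableTypeR R) setT
    (fun x : R => a * x + b)%R.
  by apply: measurable_funD => //; exact: measurable_funM.
pose phi : measurableTypeR R -> measurableTypeR R := (fun x => a * x + b)%R.
pose nu : {measure set (measurableTypeR R) -> \bar R} :=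
  mscale (NngNum (ltW a0)) (pushforward mu phi).
suff /(_ _ mA) : forall B, measurable B -> mu B = nu mphi B by [].
apply: (@lebesgue_measure_unique R (nu mphi)) => // _ [[x y] /= _ <-].
rewrite /nu /mscale /= /pushforward /=.
have -> : (fun x : R => a * x + b)%R @^-1` `]x, y]
    = `]((x - b) / a)%R, ((y - b) / a)%R]%classic.
  apply/seteqP; split => z /=; rewrite !in_itv/= => /andP[h1 h2];
    apply/andP; split.
  - by rewrite ltr_pdivrMr// ltrBlDr mulrC.
  - by rewrite ler_pdivlMr// lerBrDr mulrC.
  - by move: h1; rewrite ltr_pdivrMr// ltrBlDr mulrC.
  - by move: h2; rewrite ler_pdivlMr// lerBrDr mulrC.
rewrite !lebesgue_measure_itv/= !lte_fin ltr_pM2r ?invr_gt0// ltrD2r.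
case: ifPn => _; last by rewrite mule0.
by rewrite -!EFinD -EFinM; congr EFin; field; rewrite gt_eqF.
Qed.

Lemma ge0_integral_affine (a b : R) (f : R -> \bar R) : (0 < a)%R ->
  measurable_fun setT f -> (forall x, 0 <= f x) ->
  \int[mu]_x f x = a%:E * \int[mu]_x f (a * x + b)%R.
Proof.
move=> a0 mf f0.
have mphi : @measurable_fun _ _ (measurableTypeR R) (measurableTypeR R) setT
    (fun x : R => a * x + b)%R.
  by apply: measurable_funD => //; exact: measurable_funM.
pose phi : measurableTypeR R -> measurableTypeR R := (fun x => a * x + b)%R.
pose nu : {measure set (measurableTypeR R) -> \bar R} :=
  mscale (NngNum (ltW a0)) (pushforward mu phi).
transitivity (\int[nu mphi]_x f x).
  by apply: eq_measure_integral => A mA _; exact: lebesgue_measure_affine.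
rewrite ge0_integral_mscale//=; congr (_ * _).
by rewrite ge0_integral_pushforward.
Qed.

End affine_substitution.

(** * Sigma-finiteness of Lebesgue measure on the plane *)

Section plane.
Local Open Scope ereal_scope.
Context {R : realType}.
Notation RM := (measurableTypeR R).
Notation mu := (@lebesgue_measure R).
Notation mu2 := (mu \x mu).

(** The squares [[-n, n]^2] have finite area and exhaust the plane. The exchange of two plane
    integrals in the induction on densities rests on this. *)
Lemma sigma_finite_plane : sigma_finite [set: RM * RM] mu2.
Proof.
pose I n : set RM := `[(- n%:R)%R : R, n%:R%R]%classic.
have mI n : measurable (I n) by exact: measurable_itv.
exists (fun n => I n `*` I n).
  apply/seteqP; split => // -[x y] _.
  exists (Num.bound (Num.max `|x : R| `|y : R|)%R) => //=.
  set n := Num.bound _.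
  have /= nb : (Num.max `|x : R| `|y : R| <= n%:R :> R)%R.
    by apply/ltW/archi_boundP; rewrite le_max normr_ge0.
  move: nb; rewrite ge_max => /andP[xn yn].
  by split; rewrite /I /= in_itv/= -ler_norml.
move=> n; split; first exact: measurableX.
rewrite product_measure1E//.
have Ioo : mu (I n) < +oo.
  by rewrite /I lebesgue_measure_itv/=; case: ifP => _; rewrite -?EFinD ltry.
by rewrite lte_mul_pinfty// ge0_fin_numE.
Qed.

(* The canonical structures of [product_measure1] only provide sigma-finiteness
   for sub-probabilities, so it is packed by hand. *)
Definition plane_measure : {sigma_finite_measure set (RM * RM)%type -> \bar R} :=
  HB.pack mu2
    (Measure_isSigmaFinite.Build _ (RM * RM)%type R mu2 sigma_finite_plane).
End plane.

(** * Integrals of functions of two independent variables *)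

Section independence.
Local Open Scope ereal_scope.
Context (d d1 d2 : measure_display) (T : measurableType d)
  (T1 : measurableType d1) (T2 : measurableType d2) (R : realType).
Variable P : probability T R.

(** The product formula on rectangles identifies the joint law with the product of the two laws;
    Tonelli then separates the integrals. *)
Lemma ge0_integral_indep (Y : {RV P >-> T1}) (X : {RV P >-> T2}) :
  (forall A B, measurable A -> measurable B ->
    P (Y @^-1` A `&` X @^-1` B) = P (Y @^-1` A) * P (X @^-1` B)) ->
  forall h : T1 * T2 -> \bar R, measurable_fun setT h -> (forall z, 0 <= h z) ->
  \int[P]_w h (Y w, X w) = \int[P]_w \int[P]_w' h (Y w, X w').
Proof.
move=> YX h mh h0.
pose Z w := (Y w, X w).
have mZ : measurable_fun setT Z by exact: measurable_fun_pair.
pose nu : {measure set (T1 * T2) -> \bar R} := pushforward P Z.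
transitivity (\int[nu mZ]_z h z).
  by rewrite ge0_integral_pushforward.
transitivity (\int[distribution P Y \x distribution P X]_z h z).
  apply: eq_measure_integral => A mA _; apply/esym.
  apply: (@product_measure_unique _ _ _ _ _ (distribution P Y)
    (distribution P X) (nu mZ)) => //.
rewrite fubini_tonelli1// ge0_integral_distribution//.
- apply: eq_integral => w _ /=; rewrite /fubini_F ge0_integral_distribution//.
  exact: measurableT_comp.
- exact: measurable_fun_fubini_tonelli_F.
- by move=> y; apply: integral_ge0.
Qed.

End independence.

(** * A variable independent of the remaining inputs *)

Section independent_rest.
Local Open Scope ereal_scope.
Context (d d0 : measure_display) (T : measurableType d) (T0 : measurableType d0)
  (R : realType) (P : probability T R) (I : eqType) (X : I -> {RV P >-> T0}).

(** [D] selects the inputs not yet consumed. With [A] the whole space the condition also contains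
    their mutual independence, which lets it survive the absorption of one of them into [Y]. *)
Definition indep_rest (d1 : measure_display) (T1 : measurableType d1)
    (Y : T -> T1) (D : pred I) :=
  forall A J (B : I -> set T0), measurable A -> uniq J -> all D J ->
    (forall i, measurable (B i)) ->
    P (Y @^-1` A `&` \bigcap_(i in [set i | i \in J]) (X i @^-1` B i)) =
    P (Y @^-1` A) * \prod_(i <- J) P (X i @^-1` B i).

Lemma indep_rest_cst (d1 : measure_display) (T1 : measurableType d1) (y : T1) D :
  (forall J (B : I -> set T0), uniq J -> (forall i, measurable (B i)) ->
    P (\bigcap_(i in [set i | i \in J]) (X i @^-1` B i)) =
    \prod_(i <- J) P (X i @^-1` B i)) -> indep_rest (cst y) D.
Proof.
move=> hX A J B mA uJ _ mB; rewrite preimage_cst; case: ifPn => _.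
  by rewrite setTI probability_setT mul1e; exact: hX.
by rewrite set0I measure0 mul0e.
Qed.

Lemma indep_rest_sub (d1 : measure_display) (T1 : measurableType d1)
    (Y : T -> T1) (D D' : pred I) :
  (forall i, D' i -> D i) -> indep_rest Y D -> indep_rest Y D'.
Proof. by move=> DD' YD A J B mA uJ /(sub_all DD') DJ mB; exact: YD. Qed.

Lemma indep_rest_comp (d1 d2 : measure_display) (T1 : measurableType d1)
    (T2 : measurableType d2) (Y : T -> T1) (f : T1 -> T2) (D : pred I) :
  measurable_fun setT f -> indep_rest Y D -> indep_rest (f \o Y) D.
Proof.
move=> mf YD A J B mA uJ DJ mB; rewrite comp_preimage; apply: YD => //.
by rewrite -[X in measurable X]setTI; exact: mf.
Qed.

Lemma indep_rest1 (d1 : measure_display) (T1 : measurableType d1)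
    (Y : T -> T1) (D : pred I) i0 : indep_rest Y D -> D i0 ->
  forall A B, measurable A -> measurable B ->
    P (Y @^-1` A `&` X i0 @^-1` B) = P (Y @^-1` A) * P (X i0 @^-1` B).
Proof.
move=> YD Di0 A B mA mB.
have := YD A [:: i0] (fun=> B) mA isT.
rewrite /= Di0 big_seq1 => /(_ isT (fun=> mB)) <-.
congr (P (_ `&` _)); apply/seteqP; split => w /=.
  by move=> h i /=; rewrite inE => /eqP ->.
by apply; rewrite /= inE.
Qed.

(** Both sides are finite measures in [A]: the law of the pair on the event [C], and the law of the
    pair scaled by [c]. They agree on rectangles, a generating family closed under intersection,
    hence everywhere. *)
Lemma indep_rest_pair (d1 : measure_display) (T1 : measurableType d1)
    (Y : {RV P >-> T1}) (D : pred I) i0 : indep_rest Y D -> D i0 ->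
  indep_rest (fun w => (Y w, X i0 w)) [pred i | D i && (i != i0)].
Proof.
move=> YD Di0 A J B mA uJ DJ mB.
set C := \bigcap_(i in _) _.
have mXB i : measurable (X i @^-1` B i).
  by rewrite -[_ @^-1` _]setTI; exact: measurable_funP.
have mC : measurable C.
  by apply: fin_bigcap_measurable => //; exact: finite_seq.
pose Z w := (Y w, X i0 w).
have mZ : measurable_fun setT Z by exact: measurable_fun_pair.
set c := \prod_(i <- J) _.
have c0 : 0 <= c by apply: prode_ge0 => i _; exact: measure_ge0.
have cfin : c \is a fin_num.
  by apply: prode_fin_num => i _; exact: (fin_num_measure P).
pose r : {nonneg R} := NngNum (fine_ge0 c0).
pose m1 : {measure set (T1 * T0) -> \bar R} := pushforward (mrestr P mC) Z.
pose m2 : {measure set (T1 * T0) -> \bar R} := mscale r (pushforward P Z).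
suff : m1 mZ A = m2 mZ A by rewrite /= /mscale/= fineK// muleC.
pose G : set (set (T1 * T0)) :=
  [set C | exists A, measurable A /\ exists B, measurable B /\ C = A `*` B].
have GI : setI_closed G.
  move=> /= _ _ [X1 [mX1 [X2 [mX2 ->]]]] [Y1 [mY1 [Y2 [mY2 ->]]]].
  rewrite -setXI; exists (X1 `&` Y1); split; first exact: measurableI.
  by exists (X2 `&` Y2); split => //; exact: measurableI.
apply: (measure_unique G (fun=> setT)) => //.
- rewrite measurable_prod_measurableType //; congr (<<s _ >>).
  rewrite predeqE; split => [[A' mA' [B' mB' <-]]|[A' [mA' [B' [mB' ->]]]]].
    by exists A'; split => //; exists B'.
  by exists A' => //; exists B'.
- by move=> _; exists setT; split => //; exists setT; split => //; rewrite setXTT.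
- by apply/seteqP; split => // x _; exists 0%N.
- move=> _ [A1 [mA1 [A2 [mA2 ->]]]].
  rewrite /= /mscale/= fineK// /pushforward /mrestr.
  have -> : Z @^-1` (A1 `*` A2) = Y @^-1` A1 `&` X i0 @^-1` A2 by [].
  rewrite (indep_rest1 YD)// -setIA.
  have i0J : i0 \notin J.
    by apply/negP => /(allP DJ) /=; rewrite eqxx andbF.
  (* The second side of the rectangle becomes the condition on input [i0], and the hypothesis on [Y]
     applies to the longer list. As [i0] is not in [J], the list stays duplicate-free and the other
     conditions are unchanged. *)
  have := YD A1 (i0 :: J) (fun i => if i == i0 then A2 else B i) mA1.
  rewrite /= i0J uJ Di0 => /(_ isT) H.
  have EJ i : i \in J -> (i == i0) = false.
    by move=> iJ; apply/negbTE; apply: contraNneq i0J => <-.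
  transitivity (P (Y @^-1` A1) * (P (X i0 @^-1` A2) * c)); last first.
    by rewrite muleA muleC.
  rewrite [c](_ : _ =
      \prod_(i <- J) P (X i @^-1` (if i == i0 then A2 else B i))); last first.
    by rewrite [LHS]big_seq [RHS]big_seq; apply: eq_bigr => i iJ; rewrite EJ.
  rewrite big_cons eqxx in H; rewrite -H.
  + congr (P (_ `&` _)); apply/seteqP; split => w /=.
      move=> [h1 h2] i /=; rewrite inE => /orP[/eqP ->|iJ].
        by rewrite eqxx.
      by rewrite EJ//; exact: h2.
    move=> h; split.
      by have := h i0; rewrite /= inE eqxx; exact.
    by move=> i /= iJ; have := h i; rewrite /= inE iJ orbT EJ//; exact.
  + by apply: sub_all DJ => i /= /andP[].
  + by move=> i; case: ifP.
- move=> _; rewrite /= /pushforward /mrestr preimage_setT setTI.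
  by rewrite (le_lt_trans (probability_le1 _ mC))// ltry.
Qed.

End independent_rest.

(** * Expectations under the exponential and uniform laws *)

Section laws.
Local Open Scope ereal_scope.
Context (d : measure_display) (T : measurableType d) (R : realType)
  (P : probability T R).
Notation RM := (measurableTypeR R).
Notation mu := (@lebesgue_measure R).

Lemma ge0_integral_exponential (X : {RV P >-> RM}) :
  (forall A : set RM, measurable A ->
    distribution P X A = exponential_prob 1 A) ->
  forall f : RM -> \bar R, measurable_fun setT f -> (forall x, 0 <= f x) ->
  \int[P]_w f (X w) =
  \int[mu]_x (f x * (if (0 <= x)%R then expR (- x) else 0%R)%:E).
Proof.
move=> hX f mf f0.
rewrite -[LHS](@ge0_integral_distribution _ _ _ _ _ P X f)//.
pose q (x : measurableTypeR R) : R := exponential_pdf 1 x.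
transitivity (\int[@exponential_prob R 1]_x f x).
  by apply: eq_measure_integral => A mA _; exact: hX.
rewrite (@ge0_integral_density _ _ R mu (@exponential_prob R 1) q)//.
- apply: eq_integral => x _; congr (_ * EFin _).
  rewrite /q /exponential_pdf patchE; case: ifPn.
    by rewrite inE/= in_itv/= andbT => ->; rewrite mul1r mulN1r.
  by rewrite notin_setE/= in_itv/= andbT => /negP/negbTE ->.
- exact: measurable_exponential_pdf.
- by move=> x; apply: exponential_pdf_ge0.
Qed.

Lemma ge0_integral_uniform (X : {RV P >-> RM}) (h01 : (0 < 1 :> R)%R) :
  (forall A : set RM, measurable A ->
    distribution P X A = uniform_prob h01 A) ->
  forall f : RM -> \bar R, measurable_fun setT f -> (forall x, 0 <= f x) ->
  \int[P]_w f (X w) =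
  \int[mu]_x (f x * (if (0 < x <= 1)%R then 1%R else 0%R)%:E).
Proof.
move=> hX f mf f0.
rewrite -[LHS](@ge0_integral_distribution _ _ _ _ _ P X f)//.
transitivity (\int[uniform_prob h01]_x f x).
  by apply: eq_measure_integral => A mA _; exact: hX.
rewrite integral_uniform// subr0 invr1 mul1e.
(* The null endpoint 0 is dropped so that record values are positive on the support of the
   density. *)
rewrite -integral_itv_obnd_cbnd; last exact: measurable_funTS.
rewrite integral_mkcond; apply: eq_integral => x _.
rewrite patchE; case: ifPn.
  by rewrite inE/= in_itv/= => ->; rewrite mule1.
by rewrite notin_setE/= in_itv/= => /negP/negbTE ->; rewrite mule0.
Qed.

End laws.

(** * One step of the record chain *)

Section transition.
Local Open Scope ereal_scope.
Context {R : realType}.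
Notation RM := (measurableTypeR R).
Notation mu := (@lebesgue_measure R).
Notation mu2 := (mu \x mu).

(** At record value [v], points below it arrive at rate [v]: the next record comes after time
    [e / v], with a value uniform below [v]. *)
Definition record_step (z : RM * RM) (e u : RM) : RM * RM :=
  ((z.1 : R) + (e : R) / (z.2 : R), (z.2 : R) * (u : R))%R.

(** The waiting density [v e^-(v (t' - t))] times the uniform density [1 / v] on []0, v]]; the
    factors [v] cancel. *)
Definition step_kernel (z z' : RM * RM) : R :=
  let: (t, v, t', v') := (z.1 : R, z.2 : R, z'.1 : R, z'.2 : R) in
  (if (t <= t') && (0 < v' <= v) then expR (- (v * (t' - t))) else 0)%R.

Let m21 : measurable_fun setT (fun x : (RM * RM) * (RM * RM) => x.2.1 : R).
Proof. exact: (measurableT_comp measurable_fst measurable_snd). Qed.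
Let m22 : measurable_fun setT (fun x : (RM * RM) * (RM * RM) => x.2.2 : R).
Proof. exact: (measurableT_comp measurable_snd measurable_snd). Qed.
Let m11 : measurable_fun setT (fun x : (RM * RM) * (RM * RM) => x.1.1 : R).
Proof. exact: (measurableT_comp measurable_fst measurable_fst). Qed.
Let m12 : measurable_fun setT (fun x : (RM * RM) * (RM * RM) => x.1.2 : R).
Proof. exact: (measurableT_comp measurable_snd measurable_fst). Qed.

Lemma measurable_fun_invr : measurable_fun setT (fun x : R => x^-1)%R.
Proof.
rewrite -(setvU [set 0%R]); apply/measurable_funU => //.
  exact: measurableC.
split; last exact: measurable_fun_set1.
apply: open_continuous_measurable_fun; first exact/closed_openC/closed_eq.
by move=> x /[!inE] /= /eqP x0; exact: inv_continuous.
Qed.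

Lemma measurable_record_step :
  measurable_fun setT (fun x : (RM * RM) * RM * RM => record_step x.1.1 x.1.2 x.2).
Proof.
have mt : measurable_fun setT (fun x : (RM * RM) * RM * RM => x.1.1.1 : R).
  exact: (measurableT_comp measurable_fst
    (measurableT_comp measurable_fst measurable_fst)).
have mv : measurable_fun setT (fun x : (RM * RM) * RM * RM => x.1.1.2 : R).
  exact: (measurableT_comp measurable_snd
    (measurableT_comp measurable_fst measurable_fst)).
have me : measurable_fun setT (fun x : (RM * RM) * RM * RM => x.1.2 : R).
  exact: (measurableT_comp measurable_snd measurable_fst).
have mu' : measurable_fun setT (fun x : (RM * RM) * RM * RM => x.2 : R).
  exact: measurable_snd.
apply: measurable_fun_pair => /=.
  apply: measurable_funD => //; apply: measurable_funM => //.
  exact: measurableT_comp measurable_fun_invr mv.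
exact: measurable_funM.
Qed.

Lemma measurable_step_kernel :
  measurable_fun setT (fun x : (RM * RM) * (RM * RM) => step_kernel x.1 x.2).
Proof.
rewrite /step_kernel; apply: measurable_fun_ifT => //=.
  apply: measurable_and; first exact: measurable_fun_ler.
  apply: measurable_and; first exact: measurable_fun_ltr.
  exact: measurable_fun_ler.
apply: measurableT_comp => //; apply: measurableT_comp => //.
by apply: measurable_funM => //; exact: measurable_funB.
Qed.

(** Substitute [t' = t + e / v] and [v' = v u]: the Jacobian factors [v^-1] and [v] cancel, and
    [e = v (t' - t)] gives the exponential of the kernel. *)
Lemma record_step_kernel (z : RM * RM) (h : RM * RM -> \bar R) :
  (0 < (z.2 : R))%R -> measurable_fun setT h -> (forall z, 0 <= h z) ->
  \int[mu]_e ((\int[mu]_u (h (record_step z e u) *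
       (if (0 < (u : R) <= 1)%R then 1%R else 0%R)%:E)) *
     (if (0 <= (e : R))%R then expR (- (e : R)) else 0%R)%:E) =
  \int[mu2]_z' (h z' * (step_kernel z z')%:E).
Proof.
case: z => t v /= v0 mh h0.
have mk : measurable_fun setT (step_kernel (t, v)).
  exact: (measurableT_comp measurable_step_kernel (measurable_pair1 (t, v))).
have k0 z' : (0 <= step_kernel (t, v) z')%R.
  by rewrite /step_kernel /=; case: ifP => // _; exact: expR_ge0.
have mhk : measurable_fun setT (fun z' => h z' * (step_kernel (t, v) z')%:E).
  by apply: emeasurable_funM => //; exact/measurable_EFinP.
have hk0 z' : 0 <= h z' * (step_kernel (t, v) z')%:E by rewrite mule_ge0// lee_fin.
rewrite fubini_tonelli1//.
have vV0 : (0 < v^-1)%R by rewrite invr_gt0.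
have mF := measurable_fun_fubini_tonelli_F (m2 := mu) _ mhk hk0.
rewrite [RHS](ge0_integral_affine t vV0); last 2 first.
- exact: mF.
- by move=> x; exact: integral_ge0.
have ma : measurable_fun setT (fun e : RM => v^-1 * e + t : R)%R.
  by apply: measurable_funD => //; exact: measurable_funM.
have F0 e : setT e -> 0 <= (fubini_F mu
    (fun z' => h z' * (step_kernel (t, v) z')%:E) \o
    (fun e : RM => v^-1 * e + t : R)%R) e by move=> _; exact: integral_ge0.
have vVe0 : 0 <= v^-1%:E by rewrite lee_fin ltW.
rewrite -[RHS](ge0_integralZl mu measurableT (measurableT_comp mF ma) F0 vVe0).
apply: eq_integral => e _; rewrite /= /fubini_F.
rewrite [in RHS](ge0_integral_affine 0 v0); last 2 first.
- by apply: (measurableT_comp mhk); exact: measurable_pair1.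
- by [].
rewrite muleA -EFinM mulVf ?gt_eqF// mul1e.
rewrite -ge0_integralZr//; last 3 first.
- apply: emeasurable_funM.
    have := measurableT_comp measurable_record_step (measurable_pair1 ((t, v), e)).
    exact: measurableT_comp.
  apply/measurable_EFinP; apply: measurable_fun_ifT => //=.
  by apply: measurable_and; [exact: measurable_fun_ltr|exact: measurable_fun_ler].
- by move=> u _; rewrite mule_ge0// lee_fin; case: ifP.
- by rewrite lee_fin; case: ifP => // _; exact: expR_ge0.
apply: eq_integral => u _; rewrite /record_step /=.
rewrite addr0 [(t + _)%R]addrC [(e / v)%R]mulrC -muleA; congr (_ * _).
rewrite -EFinM; congr EFin; rewrite /step_kernel /= addrK mulVKf ?gt_eqF//.
rewrite lerDr pmulr_rge0// pmulr_rgt0// ger_pMr//.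
by case: ifP => _; case: ifP => _; rewrite ?(mul1r, mul0r, mulr0).
Qed.

End transition.

(** * Derivatives and the fundamental theorem of calculus *)

Section calculus.
Context {R : realType}.
Notation mu := (@lebesgue_measure R).

Lemma is_derive_continuous (f df : R -> R) :
  (forall x : R, is_derive x 1 f (df x)) -> continuous f.
Proof.
move=> fdf x; apply: differentiable_continuous; apply/derivable1_diffP.
exact: (@ex_derive _ _ _ _ _ _ _ (fdf x)).
Qed.

Lemma integral_is_derive (F f : R -> R) a b : a <= b ->
  (forall x : R, is_derive x 1 F (f x)) -> continuous f ->
  (\int[mu]_(x in `[a, b]) (f x)%:E = (F b - F a)%:E)%E.
Proof.
move=> ab dF cf; move: ab; rewrite le_eqVlt => /predU1P[<-|ab].
  by rewrite set_itv1 integral_set1 subrr.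
have cF := is_derive_continuous dF.
rewrite (@continuous_FTC2 _ f F)//.
- exact: continuous_subspaceT.
- split => [x _||].
  + exact: (@ex_derive _ _ _ _ _ _ _ (dF x)).
  + exact/cvg_at_right_filter/cF.
  + exact/cvg_at_left_filter/cF.
- by move=> x _; rewrite derive1E; exact: (@derive_val _ _ _ _ _ _ _ (dF x)).
Qed.

Lemma is_derive_affine (al be x : R) :
  is_derive x 1 (fun x : R => al + be * x) be.
Proof.
apply: (is_derive_eq (is_deriveD (is_derive_cst al x 1)
  (is_deriveM (is_derive_cst be x 1) (is_derive_id x 1)))).
by rewrite add0r scaler0 addr0 /cst /= [LHS]mulr1.
Qed.

Lemma is_derive_comp_affine (f df : R -> R) (al be x : R) :
  (forall x : R, is_derive x 1 f (df x)) ->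
  is_derive x 1 (fun x : R => f (al + be * x)) (df (al + be * x) * be).
Proof.
move=> fdf; apply: (@is_derive1_comp _ f (fun x => al + be * x)).
exact: is_derive_affine.
Qed.

(* If [w] is the derivative of [y * q y], then
   [w (c * p x)] integrates to [p x * q (c * p x)] without dividing by [c]. *)
Lemma is_derive_mul_scaled (q dq w : R -> R) (c al be x : R) :
  (forall y : R, is_derive y 1 q (dq y)) -> (forall y, q y + y * dq y = w y) ->
  is_derive x 1 (fun x : R => (al + be * x) * q (c * (al + be * x)))
    (be * w (c * (al + be * x))).
Proof.
move=> qdq qw.
have -> : (fun x : R => (al + be * x) * q (c * (al + be * x))) =
    (fun x : R => al + be * x) * (fun x : R => q (c * al + c * be * x)).
  by apply/funext => y; rewrite fctE/= mulrDr mulrA.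
apply: (is_derive_eq (is_deriveM (is_derive_affine al be x)
  (is_derive_comp_affine (c * al) (c * be) x qdq))).
rewrite -qw /GRing.scale /= (_ : c * al + c * be * x = c * (al + be * x));
  last by ring.
by ring.
Qed.

End calculus.

(** * The densities and their recursion *)

Section record_density.
Context {R : realType}.
Notation RM := (measurableTypeR R).
Notation mu := (@lebesgue_measure R).
Notation mu2 := (mu \x mu)%E.
Notation g := (@stirling_gen R).
Notation g1 := (@stirling_gen1 R).
Notation g2 := (@stirling_gen2 R).

Lemma continuous_stirling_gen j : continuous (g j).
Proof. exact/is_derive_continuous/is_derive_stirling_gen. Qed.

Lemma continuous_stirling_gen1 j : continuous (g1 j).
Proof. exact/is_derive_continuous/is_derive_stirling_gen1. Qed.

(** Index [j] belongs to the pair after [j + 1] steps: [g_0 = 1] already describes the first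
    record. *)
Definition record_density (j : nat) (z : RM * RM) : R :=
  let: (t, v) := (z.1 : R, z.2 : R) in
  if (0 <= t) && (0 < v <= 1) then expR (- t) * g j (t * (1 - v)) else 0.

Lemma record_density_ge0 j z : 0 <= record_density j z.
Proof.
rewrite /record_density; case: ifP => // /and3P[t0 _ v1].
by rewrite mulr_ge0 ?expR_ge0// stirling_gen_ge0// mulr_ge0// subr_ge0.
Qed.

Lemma measurable_record_density j : measurable_fun setT (record_density j).
Proof.
have m1 : measurable_fun setT (fun z : RM * RM => z.1 : R) := measurable_fst.
have m2 : measurable_fun setT (fun z : RM * RM => z.2 : R) := measurable_snd.
rewrite /record_density; apply: measurable_fun_ifT => //=.
  apply: measurable_and; first exact: measurable_fun_ler.
  by apply: measurable_and; [exact: measurable_fun_ltr|exact: measurable_fun_ler].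
apply: measurable_funM.
  by apply: measurableT_comp => //; exact: measurableT_comp.
have mg : measurable_fun setT (g j).
  by apply: continuous_measurable_fun; exact: continuous_stirling_gen.
apply: (measurableT_comp mg); apply: measurable_funM => //.
exact: measurable_funB.
Qed.

Let q j y : R := expR (- y) * g1 j y.
Let dq j y : R := expR (- y) * g2 j y - expR (- y) * g1 j y.

Lemma is_derive_expRN (x : R) :
  is_derive x 1 (fun x : R => expR (- x)) (- expR (- x)).
Proof.
apply: (is_derive_eq (is_derive1_comp (is_derive_expR (- x))
  (is_deriveN (is_derive_id x 1)))).
by rewrite mulrN1.
Qed.

Let q_derive j (y : R) : is_derive y 1 (q j) (dq j y).
Proof.
rewrite (_ : q j = (fun y : R => expR (- y)) * g1 j)//.
apply: (is_derive_eq (is_deriveM (is_derive_expRN y)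
  (is_derive_stirling_gen1 j y))).
by rewrite /dq /GRing.scale /=; ring.
Qed.

(** Multiplied by [e^-y], the differential equation becomes exact:
    [(y e^-y g_(j+1)')' = e^-y g_j]. *)
Let q_w j y : q j.+1 y + y * dq j.+1 y = expR (- y) * g j y.
Proof. by rewrite -stirling_gen_ode /q /dq; ring. Qed.

Lemma continuous_mull (c : R) (f : R -> R) :
  continuous f -> continuous (fun x => c * f x).
Proof.
move=> cf x; apply: (@continuousM _ _ (cst c) f); first exact: cst_continuous.
exact: cf.
Qed.

Lemma continuous_affine (al be : R) : continuous (fun x : R => al + be * x).
Proof. exact: is_derive_continuous (is_derive_affine al be). Qed.

Lemma continuous_comp_scaled (w : R -> R) (c al be : R) : continuous w ->
  continuous (fun x : R => w (c * (al + be * x))).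
Proof.
move=> cw x; apply: (@continuous_comp _ _ _ (fun x => c * (al + be * x)) w).
  exact/continuous_mull/continuous_affine.
exact: cw.
Qed.

Lemma continuous_expRN_stirling_gen j :
  continuous (fun y : R => expR (- y) * g j y).
Proof.
move=> y; apply: (@continuousM _ _ (fun y => expR (- y)) (g j)).
  exact: (is_derive_continuous is_derive_expRN).
exact: continuous_stirling_gen.
Qed.

(** The exponentials combine to [e^-(v t') e^-((1 - v) t)], so up to a constant factor the integrand
    is [e^-y g_j(y)] at [y = (1 - v) t]. Its primitive in [t] is [t q_(j+1)((1 - v) t)], also at
    [v = 1]. *)
Lemma integral_record_density_time j (t' v : R) : 0 <= t' ->
  (\int[mu]_(t in `[0%R, t'])
     (expR (- t) * g j (t * (1 - v)) * expR (- (v * (t' - t))))%:E =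
   (t' * expR (- t') * g1 j.+1 (t' * (1 - v)))%:E)%E.
Proof.
move=> t'0.
pose w y : R := expR (- y) * g j y.
(* [0 + 1 * t] puts the variable into the affine form [al + be * x] of [is_derive_mul_scaled]. *)
pose F (t : R) : R := (0 + 1 * t) * q j.+1 ((1 - v) * (0 + 1 * t)).
have dF (t : R) : is_derive t 1 F (1 * w ((1 - v) * (0 + 1 * t))).
  by apply: is_derive_mul_scaled; [exact: q_derive|exact: q_w].
transitivity (\int[mu]_(t in `[0%R, t'])
    (expR (- (v * t')) * (1 * w ((1 - v) * (0 + 1 * t))))%:E)%E.
  apply: eq_integral => t _; congr EFin; rewrite /w add0r !mul1r.
  rewrite [RHS]mulrA -expRD mulrAC -expRD mulrC [t * _]mulrC.
  by rewrite mulrC; congr (expR _ * _); ring.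
pose F' := fun t => expR (- (v * t')) * F t.
have dF' (t : R) :
    is_derive t 1 F' (expR (- (v * t')) * (1 * w ((1 - v) * (0 + 1 * t)))).
  rewrite (_ : F' = cst (expR (- (v * t'))) * F)//.
  apply: (is_derive_eq (is_deriveM (is_derive_cst _ t 1) (dF t))).
  by rewrite scaler0 addr0.
rewrite (integral_is_derive t'0 dF').
  rewrite /F' /F /q; congr EFin.
  rewrite !(add0r, mul1r, mul0r, mulr0, subr0).
  rewrite mulrCA (mulrA (expR _)) -expRD (mulrC (1 - v)) -mulrA.
  by congr (_ * (expR _ * _)); ring.
do 2 apply: continuous_mull.
exact/continuous_comp_scaled/continuous_expRN_stirling_gen.
Qed.

(** A primitive in [v] is [- e^-t' g_(j+1)(t' (1 - v))], which vanishes at [v = 1] because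
    [g_(j+1)(0) = 0]. *)
Lemma integral_stirling_gen1 j (t' v' : R) : v' <= 1 ->
  (\int[mu]_(v in `[v', 1%R])
     (t' * expR (- t') * g1 j.+1 (t' * (1 - v)))%:E =
   (expR (- t') * g j.+1 (t' * (1 - v')))%:E)%E.
Proof.
move=> v'1.
pose F (v : R) : R := - expR (- t') * g j.+1 (t' + - t' * v).
pose f (v : R) : R := - expR (- t') * (- t' * g1 j.+1 (t' + - t' * v)).
have dF (v : R) : is_derive v 1 F (f v).
  rewrite (_ : F = cst (- expR (- t')) * (fun v => g j.+1 (t' + - t' * v)))//.
  apply: (is_derive_eq (is_deriveM (is_derive_cst _ v 1)
    (is_derive_comp_affine t' (- t') v (is_derive_stirling_gen j.+1)))).
  by rewrite scaler0 addr0 /f [- t' * _]mulrC.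
transitivity (\int[mu]_(v in `[v', 1%R]) (f v)%:E)%E.
  apply: eq_integral => v _; rewrite /f (_ : t' + - t' * v = t' * (1 - v)); last by ring.
  by congr EFin; ring.
rewrite (integral_is_derive v'1 dF).
  rewrite /F mulr1 subrr stirling_gen_at0 mulr0 sub0r mulNr opprK.
  by rewrite (_ : t' + - t' * v' = t' * (1 - v'))//; ring.
do 2 apply: continuous_mull; move=> v.
apply: (@continuous_comp _ _ _ (fun v => t' + - t' * v) (g1 j.+1)).
  exact: continuous_affine.
exact: continuous_stirling_gen1.
Qed.

(** The supports leave [0 <= t <= t'] and [v' <= v <= 1]. The integral over [t] produces [g_(j+1)'],
    and the integral over [v] turns it into [g_(j+1)]. *)
Lemma integral_record_density_kernel j (z' : RM * RM) :
  (\int[mu2]_z ((record_density j z)%:E * (step_kernel z z')%:E) =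
   (record_density j.+1 z')%:E)%E.
Proof.
case: z' => t' v'.
have mk : measurable_fun setT (fun z => step_kernel z (t', v')).
  exact: (measurableT_comp measurable_step_kernel (measurable_pair2 (t', v'))).
have k0 z : (0 <= step_kernel z (t', v'))%R.
  by rewrite /step_kernel /=; case: ifP => // _; exact: expR_ge0.
rewrite fubini_tonelli2; last 2 first.
- apply: emeasurable_funM; apply/measurable_EFinP => //.
  exact: measurable_record_density.
- by move=> z; rewrite mule_ge0// lee_fin// record_density_ge0.
rewrite /fubini_G.
have [/and3P[t'0 v'0 v'1]|dom] := boolP [&& 0 <= t', 0 < v' & v' <= 1]; last first.
  rewrite {2}/record_density /= (negbTE dom).
  apply: integral0_eq => v _; apply: integral0_eq => t _.
  rewrite /record_density /step_kernel /= -EFinM; congr EFin.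
  case: ifP => [/and3P[t0 v0 v1]|]; last by rewrite mul0r.
  case: ifP => [/and3P[tt' v'0 v'v]|]; last by rewrite mulr0.
  by move: dom; rewrite (le_trans t0 tt') v'0 (le_trans v'v v1).
rewrite {2}/record_density /= t'0 v'0 v'1 -integral_stirling_gen1//.
rewrite [RHS]integral_mkcond; apply: eq_integral => v _.
rewrite patchE mem_setE in_itv /=; case: ifPn => [/andP[v'v v1]|vd]; last first.
  apply: integral0_eq => t _.
  rewrite /record_density /step_kernel /= -EFinM; congr EFin.
  case: ifP => [/and3P[t0 v0 v1]|]; last by rewrite mul0r.
  case: ifP => [/and3P[tt' _ v'v]|]; last by rewrite mulr0.
  by move: vd; rewrite v1 v'v.
rewrite -integral_record_density_time// [RHS]integral_mkcond.
apply: eq_integral => t _.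
rewrite /record_density /step_kernel /= patchE mem_setE in_itv /=.
rewrite v1 (lt_le_trans v'0 v'v) v'0 v'v !andbT.
case: ifP => t0 /=; last by rewrite mul0e.
by case: ifP => tt'; rewrite ?mule0.
Qed.

End record_density.

(** * The law of the record chain *)

Section record_chain.
Local Open Scope ereal_scope.
Context (R : realType) (d : measure_display) (T : measurableType d)
  (P : probability T R).
Notation RM := (measurableTypeR R).
Notation mu := (@lebesgue_measure R).
Notation mu2 := (mu \x mu).
Variables E U : nat -> {RV P >-> RM}.
Hypothesis h01 : (0 < 1 :> R)%R.
Hypothesis hE : forall j (A : set RM), measurable A ->
  distribution P (E j) A = exponential_prob 1 A.
Hypothesis hU : forall j (A : set RM), measurable A ->
  distribution P (U j) A = uniform_prob h01 A.

Definition record_input (i : nat + nat) : {RV P >-> RM} :=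
  match i with inl j => E j | inr j => U j end.

Hypothesis hind : forall (J : seq (nat + nat)) (B : nat + nat -> set RM),
  uniq J -> (forall i, measurable (B i)) ->
  P (\bigcap_(i in [set i | i \in J]) (record_input i @^-1` B i)) =
  \prod_(i <- J) P (record_input i @^-1` B i).

Fixpoint record_state (k : nat) (w : T) : RM * RM :=
  if k is k'.+1 then record_step (record_state k' w) (E k' w) (U k' w)
  else (0 : R, 1 : R)%R.

Lemma measurable_record_state k : measurable_fun setT (record_state k).
Proof.
elim: k => [|k IH] /=; first exact: measurable_cst.
have mZ : measurable_fun setT (fun w => (record_state k w, E k w, U k w)).
  by apply: measurable_fun_pair => //; exact: measurable_fun_pair.
exact: (measurableT_comp measurable_record_step mZ).
Qed.

HB.instance Definition _ k := isMeasurableFun.Build _ _ _ _ (record_state k)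
  (measurable_record_state k).

(** The stage between absorbing [E k] and absorbing [U k]: the inputs of a step are treated one at a
    time. *)
Definition state_input k (w : T) : RM * RM * RM := (record_state k w, E k w).

Lemma measurable_state_input k : measurable_fun setT (state_input k).
Proof. exact: measurable_fun_pair. Qed.

HB.instance Definition _ k := isMeasurableFun.Build _ _ _ _ (state_input k)
  (measurable_state_input k).

(** Indices of the inputs that the first [k] steps do not read. *)
Let later k : pred (nat + nat) :=
  fun i => match i with inl j | inr j => (k <= j)%N end.

Lemma state_input_indep k : indep_rest record_input (record_state k) (later k) ->
  indep_rest record_input (state_input k) [pred i | later k i && (i != inl k)].
Proof.
move=> IH; exact: (@indep_rest_pair _ _ _ _ _ _ _ record_input _ _
  (record_state k : {RV P >-> (RM * RM)%type}) (later k) (inl k) IH (leqnn k)).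
Qed.

(** A step absorbs [E k], then [U k]; every index from [k + 1] on survives both removals. *)
Lemma record_state_indep k :
  indep_rest record_input (record_state k) (later k).
Proof.
elim: k => [|k IH]; first exact: indep_rest_cst hind.
have H1 := state_input_indep IH.
have H2 := @indep_rest_pair _ _ _ _ _ _ _ record_input _ _
  (state_input k : {RV P >-> (RM * RM * RM)%type}) _ (inr k) H1.
have := indep_rest_comp measurable_record_step (H2 _).
rewrite /= leqnn => /(_ isT); apply: indep_rest_sub => -[j|j] /= kj.
  by rewrite (ltnW kj) /= !andbT; apply/eqP => -[jk]; rewrite jk ltnn in kj.
by rewrite (ltnW kj) /=; apply/eqP => -[jk]; rewrite jk ltnn in kj.
Qed.

(** The transition operator of the chain: the expectation of [h] one step after [z]. *)
Definition step_op (h : RM * RM -> \bar R) (z : RM * RM) : \bar R :=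
  \int[mu]_e ((\int[mu]_u (h (record_step z e u) *
       (if (0 < (u : R) <= 1)%R then 1%R else 0%R)%:E)) *
     (if (0 <= (e : R))%R then expR (- (e : R)) else 0%R)%:E).

Section step_op.
Variable h : RM * RM -> \bar R.
Hypotheses (mh : measurable_fun setT h) (h0 : forall z, 0 <= h z).

Let u01 (u : RM) : \bar R := (if (0 < (u : R) <= 1)%R then 1%R else 0%R)%:E.
Let e0 (e : RM) : \bar R := (if (0 <= (e : R))%R then expR (- (e : R)) else 0%R)%:E.

Let mu01 : measurable_fun setT u01.
Proof.
apply/measurable_EFinP; apply: measurable_fun_ifT => //=.
by apply: measurable_and; [exact: measurable_fun_ltr|exact: measurable_fun_ler].
Qed.

Let me0 : measurable_fun setT e0.
Proof.
apply/measurable_EFinP; apply: measurable_fun_ifT => //=.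
  exact: measurable_fun_ler.
by apply: measurableT_comp => //; exact: measurableT_comp.
Qed.

Let h1 (y : RM * RM * RM) := \int[mu]_u (h (record_step y.1 y.2 u) * u01 u).

Let mh1' : measurable_fun setT
  (fun y : RM * RM * RM * RM => h (record_step y.1.1 y.1.2 y.2)).
Proof. exact: (measurableT_comp mh measurable_record_step). Qed.

Let mh1 : measurable_fun setT h1.
Proof.
apply: (measurable_fun_fubini_tonelli_F (fun y : RM * RM * RM * RM =>
  h (record_step y.1.1 y.1.2 y.2) * u01 y.2)) => [|y].
  apply: emeasurable_funM => //; exact: measurableT_comp.
by rewrite mule_ge0// /u01 lee_fin; case: ifP.
Qed.

Let h1_ge0 y : 0 <= h1 y.
Proof.
by apply: integral_ge0 => u _; rewrite mule_ge0// /u01 lee_fin; case: ifP.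
Qed.

Let e0_ge0 e : 0 <= e0 e.
Proof. by rewrite /e0 lee_fin; case: ifP => // _; exact: expR_ge0. Qed.

Lemma step_op_ge0 z : 0 <= step_op h z.
Proof.
apply: integral_ge0 => e _; apply: mule_ge0; last exact: e0_ge0.
exact: (h1_ge0 (z, e)).
Qed.

Lemma measurable_step_op : measurable_fun setT (step_op h).
Proof.
apply: (measurable_fun_fubini_tonelli_F (fun y : RM * RM * RM =>
  h1 y * e0 y.2)) => [|y].
  apply: emeasurable_funM => //; exact: measurableT_comp.
by rewrite mule_ge0.
Qed.

(** [U k] is independent of the state joined with [E k], and [E k] of the state; they are averaged
    out in that order. *)
Lemma record_state_transition k :
  \int[P]_w h (record_state k.+1 w) = \int[P]_w step_op h (record_state k w).
Proof.
have kk : later k (inl k) by exact: leqnn.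
have IH := @record_state_indep k.
have H1 := state_input_indep IH.
have kU : [pred i | later k i && (i != inl k)] (inr k) by rewrite /= leqnn.
transitivity (\int[P]_w h1 (state_input k w)).
  have := ge0_integral_indep (indep_rest1 H1 kU) mh1' (fun y => h0 _).
  move=> /= ->; apply: eq_integral => w _.
  rewrite (ge0_integral_uniform (hU k)
    (f := fun u => h (record_step (state_input k w).1 (state_input k w).2 u)))//.
  exact: (measurableT_comp mh1' (measurable_pair1 (state_input k w))).
have := ge0_integral_indep (indep_rest1 IH kk) mh1 h1_ge0.
move=> /= ->; apply: eq_integral => w _.
rewrite (ge0_integral_exponential (hE k) (f := fun e => h1 (record_state k w, e)))//.
exact: (measurableT_comp mh1 (measurable_pair1 (record_state k w))).
Qed.

End step_op.

Lemma record_state_density k (h : RM * RM -> \bar R) :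
  measurable_fun setT h -> (forall z, 0 <= h z) ->
  \int[P]_w h (record_state k.+1 w) =
  \int[mu2]_z (h z * (record_density k z)%:E).
Proof.
elim: k h => [|k IH] h mh h0; rewrite record_state_transition//.
  (* The start [(0, 1)] is deterministic, and the kernel from there is [e^-t'] on its support, the
     density with [g_0 = 1]. *)
  transitivity (step_op h (0 : R, 1 : R)%R).
    rewrite -[RHS]mule1.
    have <- : P setT = 1 by exact: probability_setT.
    have <- := integral_cst P measurableT (step_op h (0 : R, 1 : R)%R).
    exact: eq_integral.
  rewrite /step_op.
  rewrite (@record_step_kernel R (0 : R, 1 : R)%R h ltr01 mh h0).
  apply: eq_integral => z _; congr (_ * EFin _).
  rewrite /step_kernel /record_density /= mul1r subr0.
  by case: ifP => // _; rewrite stirling_gen0 mulr1.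
rewrite IH; [|exact: measurable_step_op|exact: step_op_ge0].
have k0 z z' : (0 <= @step_kernel R z z')%R.
  by rewrite /step_kernel /=; case: ifP => // _; exact: expR_ge0.
pose G (x : (RM * RM) * (RM * RM)) : \bar R :=
  h x.2 * ((record_density k x.1)%:E * (step_kernel x.1 x.2)%:E).
have mG : measurable_fun setT G.
  apply: emeasurable_funM; first exact: measurableT_comp.
  apply: emeasurable_funM; apply/measurable_EFinP.
    by apply: (measurableT_comp (measurable_record_density k)).
  exact: measurable_step_kernel.
have G0 x : 0 <= G x.
  by rewrite !mule_ge0// lee_fin// record_density_ge0.
transitivity (\int[mu2]_z \int[mu2]_z' G (z, z')).
  apply: eq_integral => z _; rewrite /G /=.
  (* The kernel formula requires [v > 0]; off the support of the density both sides are zero. *)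
  have [zd|zd] := boolP ((0 <= (z.1 : R)) && (0 < (z.2 : R) <= 1))%R; last first.
    rewrite /record_density (negbTE zd) mule0.
    by apply/esym/integral0_eq => z' _; rewrite mul0e mule0.
  have /and3P[_ z20 _] := zd.
  rewrite /step_op (record_step_kernel z20)// -ge0_integralZr//; last 3 first.
  - apply: emeasurable_funM => //; apply/measurable_EFinP.
    exact: (measurableT_comp measurable_step_kernel (measurable_pair1 z)).
  - by move=> z' _; rewrite mule_ge0// lee_fin.
  - by rewrite lee_fin record_density_ge0.
  by apply: eq_integral => z' _; rewrite -muleA [_%:E * _]muleC.
(* After the exchange, the inner integral for a fixed target [z'] is the density against the kernel,
   which is the next density. *)
transitivity (\int[mu2]_z' \int[mu2]_z G (z, z')).
  exact: (fubini_tonelli (m1 := plane_measure) (m2 := plane_measure) G mG G0).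
apply: eq_integral => z' _.
rewrite /G /= ge0_integralZl//.
- by rewrite integral_record_density_kernel.
- apply: emeasurable_funM; apply/measurable_EFinP.
    exact: measurable_record_density.
  exact: (measurableT_comp measurable_step_kernel (measurable_pair2 z')).
- by move=> z _; rewrite mule_ge0// lee_fin// record_density_ge0.
Qed.

End record_chain.

(** * Integration of the density over the event *)

Section survival.
Context {R : realType}.
Notation RM := (measurableTypeR R).
Notation mu := (@lebesgue_measure R).
Notation mu2 := (mu \x mu)%E.
Notation g := (@stirling_gen R).
Notation g1 := (@stirling_gen1 R).
Notation g2 := (@stirling_gen2 R).

(** [gen_mean j] is [Q] for [k = j + 1]; as [(y Q)' = g_j], it is for [y > 0] the mean of [g_j] over
    [[0, y]]. [gen_mean1] is its derivative, and [gen_sum j] is [p_0 + ... + p_j]. *)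
Definition gen_mean (j : nat) : R -> R := \sum_(i < j.+1) (g i - g1 i).
Definition gen_mean1 (j : nat) (y : R) : R := \sum_(i < j.+1) (g1 i y - g2 i y).
Definition gen_sum (j : nat) (x : R) : R := \sum_(i < j.+1) expR (- x) * g i x.

Lemma is_derive_gen_mean j (y : R) : is_derive y 1 (gen_mean j) (gen_mean1 j y).
Proof.
apply: is_derive_sum => i.
exact: (is_deriveB (is_derive_stirling_gen i y) (is_derive_stirling_gen1 i y)).
Qed.

(* The differential equations of the [g i] telescope. *)
Lemma gen_mean_ode j y : gen_mean j y + y * gen_mean1 j y = g j y.
Proof.
rewrite /gen_mean /gen_mean1 fct_sumE.
elim: j => [|j IH].
  by rewrite !big_ord1 !fctE stirling_gen0 stirling_gen1_0 stirling_gen2_0; ring.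
rewrite big_ord_recr [in X in _ + X]big_ord_recr /= mulrDr addrACA IH.
by rewrite !fctE -(stirling_gen_ode j); ring.
Qed.

Lemma is_derive_gen_sum j (x : R) :
  is_derive x 1 (gen_sum j) (- (expR (- x) * gen_mean j x)).
Proof.
have -> : gen_sum j = \sum_(i < j.+1) ((fun x : R => expR (- x)) * g i).
  by apply/funext => y; rewrite fct_sumE.
apply: is_derive_eq.
  apply: is_derive_sum => i.
  exact: (is_deriveM (is_derive_expRN x) (is_derive_stirling_gen i x)).
rewrite /gen_mean fct_sumE mulr_sumr -sumrN; apply: eq_bigr => i _.
by rewrite /GRing.scale /= !fctE; ring.
Qed.

Lemma gen_sum0 j : gen_sum j 0 = 1.
Proof.
rewrite /gen_sum big_ord_recl oppr0 expR0 mul1r stirling_gen0 big1 ?addr0//.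
by move=> i _; rewrite stirling_gen_at0 mulr0.
Qed.

Lemma continuous_gen_mean j : continuous (gen_mean j).
Proof. exact: is_derive_continuous (is_derive_gen_mean j). Qed.

(** By [gen_mean_ode] a primitive in [v] is [- (1 - v) Q(x (1 - v))], which vanishes at [v = 1] and
    avoids division by [x]. *)
Lemma integral_stirling_gen_mean j (x a : R) : a <= 1 ->
  (\int[mu]_(v in `[a, 1%R]) (g j (x * (1 - v)))%:E =
   ((1 - a) * gen_mean j (x * (1 - a)))%:E)%E.
Proof.
move=> a1.
pose F (v : R) : R := (1 + -1 * v) * gen_mean j (x * (1 + -1 * v)).
have dF (v : R) : is_derive v 1 F (-1 * g j (x * (1 + -1 * v))).
  apply: is_derive_mul_scaled; first exact: is_derive_gen_mean.
  exact: gen_mean_ode.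
have dF' (v : R) : is_derive v 1 (cst (-1) * F) (-1 * (-1 * g j (x * (1 + -1 * v)))).
  apply: (is_derive_eq (is_deriveM (is_derive_cst _ v 1) (dF v))).
  by rewrite scaler0 addr0.
transitivity (\int[mu]_(v in `[a, 1%R])
    (-1 * (-1 * g j (x * (1 + -1 * v))))%:E)%E.
  by apply: eq_integral => v _; rewrite !mulN1r opprK.
rewrite (integral_is_derive a1 dF').
  by rewrite !fctE /F /= !mulN1r subrr mul0r opprK oppr0 add0r.
do 2 apply: continuous_mull.
exact/continuous_comp_scaled/continuous_stirling_gen.
Qed.

(** The preceding integral with [a = 0] exhibits [Q(x)] as an average of values of [g_j] at
    nonnegative points. *)
Lemma gen_mean_ge0 j x : 0 <= x -> 0 <= gen_mean j x.
Proof.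
move=> x0; have := @integral_stirling_gen_mean j x 0 ler01.
rewrite subr0 mul1r mulr1 -lee_fin => <-.
apply: integral_ge0 => v /=; rewrite in_itv/= => /andP[_ v1].
by rewrite lee_fin stirling_gen_ge0// mulr_ge0// subr_ge0.
Qed.

Lemma integral_stirling_gen j (s : R) : 0 <= s ->
  (\int[mu]_(x in `[0%R, s]) (g j x)%:E = (s * gen_mean j s)%:E)%E.
Proof.
move=> s0.
pose F (v : R) : R := (0 + 1 * v) * gen_mean j (1 * (0 + 1 * v)).
have dF (v : R) : is_derive v 1 F (1 * g j (1 * (0 + 1 * v))).
  apply: is_derive_mul_scaled; first exact: is_derive_gen_mean.
  exact: gen_mean_ode.
transitivity (\int[mu]_(x in `[0%R, s]) (1 * g j (1 * (0 + 1 * x)))%:E)%E.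
  by apply: eq_integral => v _; rewrite !mul1r add0r.
rewrite (integral_is_derive s0 dF).
  by rewrite /F !mul1r !add0r mul0r subr0.
apply: continuous_mull.
exact/continuous_comp_scaled/continuous_stirling_gen.
Qed.

Lemma integral_exp_gen_mean j (s : R) : 0 <= s ->
  (\int[mu]_(x in `[0%R, s]) (expR (- x) * gen_mean j x)%:E =
   (1 - gen_sum j s)%:E)%E.
Proof.
move=> s0.
have dF (x : R) : is_derive x 1 (- gen_sum j) (expR (- x) * gen_mean j x).
  by apply: (is_derive_eq (is_deriveN (is_derive_gen_sum j x))); rewrite opprK.
rewrite (integral_is_derive s0 dF).
  by rewrite !fctE gen_sum0 opprK addrC.
move=> x; apply: (@continuousM _ _ (fun x => expR (- x)) (gen_mean j)).
  exact: (is_derive_continuous is_derive_expRN).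
exact: continuous_gen_mean.
Qed.

(** On [[s, +oo[] the integrand is at most [s^-1 e^-x], so the integral is finite and its real part
    [Iexp] is its true value. *)
Lemma Iexp_fin (s : R) : 0 < s ->
  (\int[mu]_(x in `[s, +oo[) (expR (- x) / x)%:E = (Iexp s)%:E)%E.
Proof.
move=> s0; rewrite /Iexp /Rintegral fineK// ge0_fin_numE; last first.
  apply: integral_ge0 => x /=; rewrite in_itv/= andbT => sx.
  by rewrite lee_fin divr_ge0 ?expR_ge0// (le_trans (ltW s0)).
have pdf0 (x : R) : (0 <= s^-1%:E * (exponential_pdf 1 x)%:E)%E.
  by rewrite -EFinM lee_fin mulr_ge0 ?invr_ge0 ?(ltW s0)// exponential_pdf_ge0.
have mpdf : measurable_fun [set: RM]
    (fun x : R => s^-1%:E * (exponential_pdf 1 x)%:E)%E.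
  apply: emeasurable_funM => //; apply/measurable_EFinP.
  exact: measurable_exponential_pdf.
apply: (@le_lt_trans _ _
    (\int[mu]_(x in `[s, +oo[) (s^-1%:E * (exponential_pdf 1 x)%:E))%E).
  apply: ge0_le_integral => //.
  - move=> x /=; rewrite in_itv/= andbT => sx.
    by rewrite lee_fin divr_ge0 ?expR_ge0// (le_trans (ltW s0)).
  - apply: measurable_funTS; apply/measurable_EFinP; apply: measurable_funM.
      by apply: measurableT_comp => //; exact: measurableT_comp.
    exact: measurable_fun_invr.
  - exact: measurable_funTS.
  - move=> x /=; rewrite in_itv/= andbT => sx.
    rewrite -EFinM lee_fin exponential_pdfE ?(le_trans (ltW s0))// mul1r mulN1r.
    by rewrite mulrC ler_wpM2r ?expR_ge0// lef_pV2// posrE// (lt_le_trans s0).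
apply: (@le_lt_trans _ _ (\int[mu]_x (s^-1%:E * (exponential_pdf 1 x)%:E))%E).
  exact: ge0_subset_integral.
rewrite ge0_integralZl//; last 3 first.
- by apply/measurable_EFinP; exact: measurable_exponential_pdf.
- by move=> x _; rewrite lee_fin exponential_pdf_ge0.
- by rewrite lee_fin invr_ge0 ltW.
by rewrite integral_exponential_pdf// mule1 ltry.
Qed.

(** At the state after [k] steps this is the indicator of [A_k <= s]. *)
Definition product_le (s : R) (z : RM * RM) : \bar R :=
  (if (z.1 : R) * (1 - (z.2 : R)) <= s then 1 else 0)%:E.

Lemma measurable_product_le s : measurable_fun setT (product_le s).
Proof.
have m1 : measurable_fun setT (fun z : RM * RM => z.1 : R) := measurable_fst.
have m2 : measurable_fun setT (fun z : RM * RM => z.2 : R) := measurable_snd.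
apply/measurable_EFinP; apply: measurable_fun_ifT => //=.
apply: measurable_fun_ler => //; apply: measurable_funM => //.
exact: measurable_funB.
Qed.

Lemma product_le_ge0 s z : (0 <= product_le s z)%E.
Proof. by rewrite /product_le lee_fin; case: ifP. Qed.

(** For [t <= s] every [v] in []0, 1]] is admissible. Otherwise the condition is [v >= a] with
    [a = 1 - s / t], and [t (1 - a) = s] makes [s] the argument of [Q]. *)
Lemma integral_product_le_section j (s t : R) : 0 < s -> 0 <= t ->
  (\int[mu]_v (product_le s (t, v) * (record_density j (t, v))%:E) =
   (if t <= s then expR (- t) * gen_mean j t
    else expR (- t) / t * (s * gen_mean j s))%:E)%E.
Proof.
move=> s0 t0.
have mgt : measurable_fun [set: RM] (fun v : R => (g j (t * (1 - v)))%:E).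
  have mg : measurable_fun setT (g j).
    by apply: continuous_measurable_fun; exact: continuous_stirling_gen.
  apply/measurable_EFinP; apply: (measurableT_comp mg).
  by apply: measurable_funM => //; exact: measurable_funB.
have mgt' : measurable_fun [set: RM]
    (fun v : R => (expR (- t))%:E * (g j (t * (1 - v)))%:E)%E.
  exact: emeasurable_funM.
have core a : a <= 1 ->
    (\int[mu]_(v in `[a, 1%R]) ((expR (- t))%:E * (g j (t * (1 - v)))%:E) =
     (expR (- t) * ((1 - a) * gen_mean j (t * (1 - a))))%:E)%E.
  move=> a1; rewrite ge0_integralZl//.
  - by rewrite integral_stirling_gen_mean.
  - exact: measurable_funTS.
  - move=> v /=; rewrite in_itv/= => /andP[_ v1].
    by rewrite lee_fin stirling_gen_ge0// mulr_ge0// subr_ge0.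
case: ifPn => [ts|].
  have := core 0 ler01; rewrite subr0 mul1r mulr1 => <-.
  rewrite -integral_itv_obnd_cbnd; last exact: measurable_funTS.
  rewrite [RHS]integral_mkcond; apply: eq_integral => v _.
  rewrite patchE mem_setE in_itv/= /product_le /record_density /= t0 /=.
  case: (boolP (0 < v <= 1)) => [/andP[v0 v1]|_]; last by rewrite mule0.
  by rewrite (le_trans _ ts) ?mul1e// ler_piMr// gerBl ltW.
rewrite -ltNge => st.
have t0' := lt_trans s0 st.
have a0 : 0 < 1 - s / t by rewrite subr_gt0 ltr_pdivrMr// mul1r.
have a1 : 1 - s / t <= 1 by rewrite gerBl divr_ge0// ltW.
have tn0 : t != 0 by rewrite gt_eqF.
transitivity (expR (- t) * ((s / t) * gen_mean j s))%:E; last first.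
  by congr EFin; ring.
have := core _ a1; rewrite subKr [t * _]mulrC divfK// => <-.
rewrite [RHS]integral_mkcond; apply: eq_integral => v _.
rewrite patchE mem_setE in_itv/= /product_le /record_density /= t0 /=.
have -> : (t * (1 - v) <= s) = (1 - s / t <= v).
  by rewrite lerBlDr -lerBlDl ler_pdivlMr// mulrC.
case: (boolP (1 - s / t <= v)) => [av|_] /=; last by rewrite mul0e.
rewrite (lt_le_trans a0 av) mul1e /=.
by case: ifP.
Qed.

(** Times up to [s] contribute the integral of [e^-t Q(t)]; later times contribute the constant
    [s Q(s)] times [e^-t / t], which integrates to [I(s)]. *)
Lemma integral_product_le j (s : R) : 0 < s ->
  (\int[mu2]_z (product_le s z * (record_density j z)%:E) =
   (1 - gen_sum j s + Iexp s * (s * gen_mean j s))%:E)%E.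
Proof.
move=> s0.
have mF : measurable_fun setT
    (fun z => product_le s z * (record_density j z)%:E)%E.
  apply: emeasurable_funM; first exact: measurable_product_le.
  by apply/measurable_EFinP; exact: measurable_record_density.
have F0 z : (0 <= product_le s z * (record_density j z)%:E)%E.
  by rewrite mule_ge0 ?product_le_ge0// lee_fin record_density_ge0.
rewrite fubini_tonelli1//.
have mG := measurable_fun_fubini_tonelli_F (m2 := mu) _ mF F0.
set G := fubini_F _ _ in mG *.
have G0 t : (0 <= G t)%E by exact: integral_ge0.
transitivity (\int[mu]_(t in `[0%R, +oo[) G t)%E.
  rewrite [RHS]integral_mkcond; apply: eq_integral => t _.
  rewrite patchE mem_setE in_itv/= andbT; case: ifPn => // t0.
  apply: integral0_eq => v _; rewrite /record_density /= (negbTE t0).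
  by rewrite mule0.
rewrite (_ : `[0%R, +oo[%classic = `[0%R, s] `|` `]s, +oo[ :> set R); last first.
  apply/seteqP; split => x /=; rewrite !in_itv/= !andbT.
    by move=> x0; rewrite x0/=; case: leP => _; [left|right].
  by move=> [/andP[]//|/(lt_trans s0)/ltW].
rewrite ge0_integral_setU//=; last 2 first.
  exact: measurable_funTS.
  apply/disj_setPS => x [] /=; rewrite !in_itv/= andbT => /andP[_ xs].
  by rewrite ltNge xs.
rewrite EFinD; congr (_ + _)%E.
  rewrite -integral_exp_gen_mean; last exact: ltW.
  apply: eq_integral => t; rewrite inE/= in_itv/= => /andP[t0 ts].
  by rewrite /G /fubini_F integral_product_le_section// ts.
transitivity (\int[mu]_(t in `]s, +oo[)
    ((expR (- t) / t)%:E * (s * gen_mean j s)%:E))%E.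
  apply: eq_integral => t; rewrite inE/= in_itv/= andbT => st.
  rewrite /G /fubini_F integral_product_le_section//; last exact/ltW/(lt_trans s0).
  by rewrite leNgt st.
have sg0 : (0 <= (s * gen_mean j s)%:E)%E.
  by rewrite lee_fin mulr_ge0 ?gen_mean_ge0// ltW.
have mex : measurable_fun [set: RM] (fun x : R => (expR (- x) / x)%:E).
  apply/measurable_EFinP; apply: measurable_funM; last exact: measurable_fun_invr.
  by apply: measurableT_comp => //; exact: measurableT_comp.
rewrite ge0_integralZr//; last 2 first.
- exact: measurable_funTS.
- move=> x /=; rewrite in_itv/= andbT => sx.
  by rewrite lee_fin divr_ge0 ?expR_ge0// (le_trans (ltW s0) (ltW sx)).
rewrite integral_itv_obnd_cbnd; last exact: measurable_funTS.
by rewrite Iexp_fin.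
Qed.

End survival.

(** * Identification of the chain with the given variables *)

Section cast.
Context {R : realType} {d : measure_display} {T : measurableType d}
  {P : probability T R}.

Lemma measurable_fun_measurableTypeR (X : {RV P >-> R}) :
  measurable_fun setT ((X : T -> R) : T -> measurableTypeR R).
Proof. exact: (measurable_funP X). Qed.

(* [R] and [measurableTypeR R] have the same measurable sets but distinct displays;
   [lebesgue_measure] lives on the latter. *)
Definition RV_measurableTypeR (X : {RV P >-> R}) : {RV P >-> measurableTypeR R} :=
  HB.pack ((X : T -> R) : T -> measurableTypeR R)
    (isMeasurableFun.Build _ _ T (measurableTypeR R) _
      (measurable_fun_measurableTypeR X)).

(** In this closed form, [A_k] is the first coordinate times one minus the second. *)
Lemma record_stateE (E U : nat -> {RV P >-> measurableTypeR R}) k (w : T) :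
  record_state E U k w =
  (\sum_(i < k) (E i w : R) / \prod_(l < i) (U l w : R), \prod_(l < k) (U l w : R)).
Proof.
elim: k => [|k IH] /=; first by rewrite !big_ord0.
by rewrite IH /record_step /= !big_ord_recr.
Qed.

End cast.

(** * The survival function of [A_k] *)

Unset Implicit Arguments.

Theorem theorem1 (R : realType) (d : measure_display) (T : measurableType d)
  (P : probability T R) (E U : nat -> {RV P >-> R})
  (h01 : (0 : R) < 1)
  (hE : forall j (A : set R), measurable A ->
          distribution P (E j) A = exponential_prob 1 A)
  (hU : forall j (A : set R), measurable A ->
          distribution P (U j) A = uniform_prob h01 A)
  (hind : mutually_independent P
            (fun i : nat + nat => match i with
                                  | inl j => (E j : T -> R)
                                  | inr j => (U j : T -> R) end))
  (k : nat) (hk : (1 <= k)%N) (s : R) (hs : 0 < s) :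
  P [set w | s < A_k (fun j => (E j : T -> R)) (fun j => (U j : T -> R)) k w] =
  (- Iexp s * Rintegral lebesgue_measure `[0, s] (fun xi => expR xi * pj k.-1 xi)
   + \sum_(0 <= j < k) pj j s)%:E.
Proof.
(* From here [k + 1] stands for the given [k], so [k.-1] becomes [k], the index of the density after
   [k + 1] steps. *)
case: k hk => // k _.
pose E' j := RV_measurableTypeR (E j).
pose U' j := RV_measurableTypeR (U j).
have hE' j (A : set (measurableTypeR R)) : measurable A ->
  distribution P (E' j) A = exponential_prob 1 A := hE j A.
have hU' j (A : set (measurableTypeR R)) : measurable A ->
  distribution P (U' j) A = uniform_prob h01 A := hU j A.
have hind' (J : seq (nat + nat)) (B : nat + nat -> set (measurableTypeR R)) :
    uniq J -> (forall i, measurable (B i)) ->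
    P (\bigcap_(i in [set i | i \in J]) (record_input E' U' i @^-1` B i)) =
    (\prod_(i <- J) P (record_input E' U' i @^-1` B i))%E.
  move=> uJ mB; have := hind J B uJ mB.
  rewrite (eq_bigcapr (G := fun i => record_input E' U' i @^-1` B i)) => [->|].
    by apply: eq_bigr => -[].
  by case.
pose Y := record_state E' U' k.+1.
pose D := [set w |
  A_k (fun j => (E j : T -> R)) (fun j => (U j : T -> R)) k.+1 w <= s].
have YE w : product_le s (Y w) = (\1_D w)%:E.
  rewrite /Y record_stateE /product_le /= indicE.
  by case: ifPn => [h|/negP h]; [rewrite (mem_set (h : D w))|
    rewrite (memNset (h : ~ D w))].
have mD : measurable D.
  have mY : measurable_fun setT (fun w => product_le s (Y w)).
    apply: (measurableT_comp (measurable_product_le s)).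
    exact: measurable_record_state.
  (* [D] is a level set of a measurable function of the chain. *)
  have -> : D = setT `&` (fun w => product_le s (Y w)) @^-1` [set 1%E].
    apply/seteqP; split => w /=; rewrite YE indicE.
      by move=> Dw; split => //; rewrite mem_set.
    move=> [_]; have [|_] := boolP (w \in D); first by rewrite inE.
    by move=> /eqP; rewrite eqe eq_sym oner_eq0.
  exact: (mY measurableT).
have PD : P D = (1 - gen_sum k s + Iexp s * (s * gen_mean k s))%:E.
  rewrite -integral_product_le// -(record_state_density hE' hU' hind')//.
  - by under eq_integral do rewrite -/Y YE; rewrite integral_indic// setIT.
  - exact: measurable_product_le.
  - exact: product_le_ge0.
rewrite (_ : [set w | _] = ~` D); last first.
  by apply/seteqP; split => w /=; rewrite ltNge => /negP.
rewrite probability_setC// PD -EFinD; congr EFin.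
(* Here [e^x p_k(x) = g_k(x)], whose integral over [[0, s]] is [s Q(s)]. *)
have -> : Rintegral lebesgue_measure `[0, s] (fun xi => expR xi * pj k xi) =
    s * gen_mean k s.
  rewrite /Rintegral -[RHS]/(fine (s * gen_mean k s)%:E).
  rewrite -integral_stirling_gen ?ltW//; congr fine.
  apply: eq_integral => x _.
  by rewrite pjE mulrA -expRD subrr expR0 mul1r.
rewrite big_mkord (eq_bigr (fun i : 'I_k.+1 => expR (- s) * stirling_gen i s)).
  by rewrite -/(gen_sum k s); ring.
by move=> i _; rewrite pjE.
Qed.
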